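(* For every $n\ge1$ there is an involution $\beta$ on the set of Tamari intervals $(P,Q)$ of size $n$ such that for every interval $I=(P,Q)$ with $\beta(I)=(P',Q')$: (i) $c_0(P')=r_0(Q)$ and $r_0(Q')=c_0(P)$; (ii) the multiset $\{c_1(P'),\dots,c_{n-1}(P')\}$ equals the multiset $\{r_1(Q),\dots,r_{n-1}(Q)\}$, and the multiset $\{r_1(Q'),\dots,r_{n-1}(Q')\}$ equals $\{c_1(P),\dots,c_{n-1}(P)\}$; (iii) $\beta$ preserves the distance: $\mathrm{dist}(P',Q')=\mathrm{dist}(P,Q)$.
   Context: Dyck paths of semilength $n$ are words in $U,D$ with $n$ of each and every prefix having at least as many $U$ as $D$; each up-step is matched with the first later down-step returning to its starting height. Tamari order: a rotation takes a down-step $D$ immediately followed by an up-step, lets $W$ be the shortest nonempty Dyck-path factor starting right after it, and replaces $DW$ by $WD$; the Tamari order is the reflexive–transitive closure. A Tamari interval of size $n$ is a pair $(P,Q)$ of Dyck paths of semilength $n$ with $P\le Q$. The distance $\mathrm{dist}(P,Q)$ is the length of a longest chain from $P$ to $Q$ in the Tamari lattice. Contact vector of $P$: $c_0(P)$ is the number of returns of $P$ to height $0$ other than at the start; for $1\le i\le n-1$, $c_i(P)$ is the number of non-initial returns to its starting height of the (possibly empty) Dyck path strictly between the $i$-th up-step of $P$ and its matching down-step. Rise vector of $Q$: $r_0(Q)$ is the number of up-steps before the first down-step; for $1\le i\le n-1$, $r_i(Q)$ is the number of up-steps in the maximal run of up-steps immediately following the $i$-th down-step of $Q$ (zero if that down-step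 is followed by a down-step). *)

(* Defs.v *)
(* Dyck paths are encoded as seq bool: true = U, false = D. *)
From Stdlib Require Import Relations.
From mathcomp Require Import all_boot.

Set Implicit Arguments.
Unset Strict Implicit.
Unset Printing Implicit Defensive.

Definition balanced (s : seq bool) : bool :=
  count (fun b : bool => b) s == count negb s.

Definition dyck_word (s : seq bool) : bool :=
  all (fun k => count negb (take k s) <= count (fun b : bool => b) (take k s))
      (iota 0 (size s).+1)
  && balanced s.

Definition dyck (n : nat) (s : seq bool) : bool :=
  (size s == 2 * n) && dyck_word s.

Definition rotation (w w' : seq bool) : Prop :=
  exists (u W v : seq bool),
    w = u ++ false :: W ++ v /\
    head false W = true /\
    W != [::] /\ dyck_word W /\
    (forall k, 0 < k < size W -> ~~ dyck_word (take k W)) /\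
    w' = u ++ W ++ false :: v.

Definition tamari_le : relation (seq bool) := clos_refl_trans (seq bool) rotation.

Definition tamari_lt (x y : seq bool) : Prop := tamari_le x y /\ x <> y.

Fixpoint chain_from (x : seq bool) (s : seq (seq bool)) (Q : seq bool) : Prop :=
  match s with
  | [::] => x = Q
  | y :: s' => tamari_lt x y /\ chain_from y s' Q
  end.

Definition is_dist (n : nat) (P Q : seq bool) (k : nat) : Prop :=
  (exists s, all (dyck n) s /\ chain_from P s Q /\ size s = k) /\
  (forall s, all (dyck n) s -> chain_from P s Q -> size s <= k).

Definition interval (n : nat) (I : seq bool * seq bool) : Prop :=
  dyck n I.1 /\ dyck n I.2 /\ tamari_le I.1 I.2.

(* 0-indexed position in w of the i-th up-step (i >= 1) *)
Definition up_pos (w : seq bool) (i : nat) : nat :=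
  nth 0 [seq j <- iota 0 (size w) | nth false w j] i.-1.

(* 0-indexed position in w of the i-th down-step (i >= 1) *)
Definition down_pos (w : seq bool) (i : nat) : nat :=
  nth 0 [seq j <- iota 0 (size w) | ~~ nth true w j] i.-1.

(* position of the down-step matching the up-step at position p: the first
   later down-step after which the height equals the height before p *)
Definition match_pos (w : seq bool) (p : nat) : nat :=
  p.+1 + find (fun j =>
     let q := p.+1 + j in
     ~~ nth true w q &&
     (count (fun b : bool => b) (take q.+1 w) + count negb (take p w)
        == count negb (take q.+1 w) + count (fun b : bool => b) (take p w)))
   (iota 0 (size w)).

Definition returns (s : seq bool) : nat :=
  count (fun k => balanced (take k s)) (iota 1 (size s)).

Definition c0 (P : seq bool) : nat := returns P.

Definition ci (P : seq bool) (i : nat) : nat :=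
  let p := up_pos P i in returns (drop p.+1 (take (match_pos P p) P)).

Definition r0 (Q : seq bool) : nat := find negb Q.

Definition ri (Q : seq bool) (i : nat) : nat :=
  find negb (drop (down_pos Q i).+1 Q).

Definition cvec (n : nat) (P : seq bool) : seq nat := [seq ci P i | i <- iota 1 n.-1].
Definition rvec (n : nat) (Q : seq bool) : seq nat := [seq ri Q i | i <- iota 1 n.-1].

(* Main.v *)
(* Write a Dyck path as a plane forest, in the binary form Node a b = U a D b.  An interval
   (P, Q) is the forest of Q with labels: if Q = U q1 D q2, then P = U a D b p2 where
   (a b, q1) and (p2, q2) are intervals, and the label of the root records how many returns
   of a b belong to a.  The contacts of P are exactly the labels (and c_0(P)), and dist(P, Q)
   is the sum of deg(a b) - label over all nodes; both are symmetric in the children of a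
   node.  So reflecting the labelled forest is an involution phi that keeps the contacts of P
   and the distance and reverses the path Q.  The order-reversing involution psi of the
   Tamari lattice is the mirror image of the binary trees read off the last returns; it turns
   the rises of the reversed path into contacts.  The required involution is phi psi phi.
   For the distance, one shows that the sum above is superadditive along chains and is
   attained by a chain of rotations. *)
Require Import Defs.
From Stdlib Require Import Relations.
From mathcomp Require Import all_boot.
From mathcomp Require Import zify.

Set Implicit Arguments.
Unset Strict Implicit.
Unset Printing Implicit Defensive.

(** * Plane forests and their statistics *)

Inductive tree := Leaf | Node of tree & tree.

Fixpoint word t : seq bool :=
  if t is Node a b then true :: word a ++ false :: word b else [::].

Fixpoint tsize t := if t is Node a b then (tsize a + tsize b).+1 else 0.

Fixpoint tcat t u := if t is Node a b then Node a (tcat b u) else u.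

Fixpoint deg t := if t is Node a b then (deg b).+1 else 0.

Fixpoint trev t := if t is Node a b then tcat (trev b) (Node (trev a) Leaf) else Leaf.

Fixpoint swap t := if t is Node a b then Node (swap b) (swap a) else Leaf.

(** Entries follow the preorder of the nodes, which is the order of their up-steps. *)
Fixpoint contacts t := if t is Node a b then deg a :: contacts a ++ contacts b else [::].

Fixpoint rise t := if t is Node a b then (rise a).+1 else 0.

(** Entries follow the inorder, which is the order of the down-steps: that of the root comes after
    those of [a] and is followed by the initial rise of [b]. *)
Fixpoint rises t := if t is Node a b then rises a ++ rise b :: rises b else [::].

Lemma tcatA t u v : tcat t (tcat u v) = tcat (tcat t u) v.
Proof. by elim: t => //= a _ b ->. Qed.

Lemma tcat0 t : tcat t Leaf = t.
Proof. by elim: t => //= a _ b ->. Qed.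

Lemma word_cat t u : word (tcat t u) = word t ++ word u.
Proof. by elim: t => //= a _ b ->; rewrite -catA. Qed.

Lemma tsize_cat t u : tsize (tcat t u) = tsize t + tsize u.
Proof. by elim: t => //= a _ b ->; lia. Qed.

Lemma deg_cat t u : deg (tcat t u) = deg t + deg u.
Proof. by elim: t => //= a _ b ->. Qed.

Lemma contacts_cat t u : contacts (tcat t u) = contacts t ++ contacts u.
Proof. by elim: t => //= a _ b ->; rewrite catA. Qed.

Lemma trev_cat t u : trev (tcat t u) = tcat (trev u) (trev t).
Proof. by elim: t => [|a _ b /= ->] /=; rewrite ?tcat0 ?tcatA. Qed.

Lemma trevK : involutive trev.
Proof. by elim=> //= a IHa b IHb; rewrite trev_cat /= IHa IHb. Qed.

Lemma swapK : involutive swap.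
Proof. by elim=> //= a -> b ->. Qed.

Lemma deg_trev t : deg (trev t) = deg t.
Proof. by elim: t => //= a IHa b IHb; rewrite deg_cat /= IHb addn1. Qed.

(** [deg] measures the right spine of the binary tree, [rise] the left one. *)
Lemma deg_swap t : deg (swap t) = rise t.
Proof. by elim: t => //= a -> b. Qed.

Lemma deg_eq0 t : deg t = 0 -> t = Leaf.
Proof. by case: t. Qed.

Lemma contacts_trev t : perm_eq (contacts (trev t)) (contacts t).
Proof.
elim: t => //= a IHa b IHb; rewrite contacts_cat /= cats0 deg_trev.
by rewrite perm_catC /= perm_cons perm_cat.
Qed.

Lemma contacts_swap t : perm_eq (contacts (swap t)) (rises t).
Proof.
elim: t => //= a IHa b IHb; rewrite deg_swap.
by rewrite perm_sym perm_catC /= perm_cons perm_sym perm_cat.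
Qed.

Lemma size_contacts t : size (contacts t) = tsize t.
Proof. by elim: t => //= a IHa b IHb; rewrite size_cat IHa IHb. Qed.

Lemma size_rises t : size (rises t) = tsize t.
Proof. by elim: t => //= a IHa b IHb; rewrite size_cat /= IHa IHb addnS. Qed.

Lemma last_contacts t : last 0 (contacts t) = 0.
Proof.
elim: t => //= a IHa b IHb; rewrite last_cat.
have -> : last (deg a) (contacts a) = 0 by case: a IHa.
by [].
Qed.

Lemma last_rises t : last 0 (rises t) = 0.
Proof.
elim: t => //= a IHa b IHb; rewrite last_cat /=; case: b IHb => //= c d.
by rewrite !last_cat.
Qed.

(** * The Tamari order on trees *)

(** At the root the path [U a D U b D c] becomes [U a U b D D c]: the factor [U b D] crosses the
    down-step before it. *)
Inductive rot : tree -> tree -> Prop :=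
| rot_root a b c : rot (Node a (Node b c)) (Node (tcat a (Node b Leaf)) c)
| rot_left a a' b : rot a a' -> rot (Node a b) (Node a' b)
| rot_right a b b' : rot b b' -> rot (Node a b) (Node a b').

Inductive rotn : nat -> tree -> tree -> Prop :=
| rotn0 t : rotn 0 t t
| rotnS k t u v : rot t u -> rotn k u v -> rotn k.+1 t v.

(* [tle P Q k]: [P] is below [Q] and the longest chain from [P] to [Q] has length [k]. *)
Inductive tle : tree -> tree -> nat -> Prop :=
| tle_leaf : tle Leaf Leaf 0
| tle_node a b p q1 q2 k1 k2 : tle (tcat a b) q1 k1 -> tle p q2 k2 ->
    tle (Node a (tcat b p)) (Node q1 q2) (k1 + k2 + deg b).

Lemma tle_nodeP p q1 q2 k : tle p (Node q1 q2) k ->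
  exists a b p' k1 k2, [/\ p = Node a (tcat b p'), tle (tcat a b) q1 k1,
    tle p' q2 k2 & k = k1 + k2 + deg b].
Proof.
move=> H; inversion H as [|a b p' ? ? k1 k2]; subst.
by exists a, b, p', k1, k2.
Qed.

Lemma tle_refl t : tle t t 0.
Proof.
elim: t => [|a IHa b IHb]; first exact: tle_leaf.
by apply: (@tle_node a Leaf b a b 0 0); rewrite ?tcat0.
Qed.

Lemma tle_cat p1 q1 k1 p2 q2 k2 : tle p1 q1 k1 -> tle p2 q2 k2 ->
  tle (tcat p1 p2) (tcat q1 q2) (k1 + k2).
Proof.
move=> H H2; elim: H => //= a b p r1 r2 l1 l2 Ha _ Hp IHp.
rewrite -tcatA; have -> : l1 + l2 + deg b + k2 = l1 + (l2 + k2) + deg b by lia.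
exact: tle_node.
Qed.

(** By [tle_node] each component of the upper forest owns a block of consecutive components of the
    lower one, so a cut above induces a cut below. *)
Lemma tle_catP p q1 q2 k : tle p (tcat q1 q2) k ->
  exists p1 p2 k1 k2, [/\ p = tcat p1 p2, tle p1 q1 k1, tle p2 q2 k2 & k = k1 + k2].
Proof.
elim: q1 p k => [|r1 _ r2 IH] p k /=.
  by move=> H; exists Leaf, p, 0, k; split=> //; exact: tle_leaf.
move=> /tle_nodeP[a [b [p' [k1 [k2 [-> H1 /IH[p1 [p2 [l1 [l2 [-> H2 H3 ->]]]]] ->]]]]]].
exists (Node a (tcat b p1)), p2, (k1 + l1 + deg b), l2; split=> //=; try lia.
  by rewrite tcatA.
exact: tle_node.
Qed.

Lemma tle_deg p q k : tle p q k -> deg q <= deg p.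
Proof. by elim=> //= a b p' q1 q2 k1 k2 _ _ _; rewrite deg_cat; lia. Qed.

Lemma tle_size p q k : tle p q k -> tsize p = tsize q.
Proof.
elim=> //= a b p' q1 q2 k1 k2 _ + _; rewrite !tsize_cat; lia.
Qed.

Lemma tle0 p q k : tle p q k -> k = 0 -> p = q.
Proof.
elim=> //= a b p' q1 q2 k1 k2 _ IH1 _ IH2 k0.
have b0 : b = Leaf by apply: deg_eq0; lia.
by move: IH1; rewrite b0 tcat0 /= => -> //; [rewrite IH2 //; lia | lia].
Qed.

Lemma rot_cat2l a b b' : rot b b' -> rot (tcat a b) (tcat a b').
Proof. by move=> H; elim: a => //= a _ c; apply: rot_right. Qed.

Lemma rot_tle p q : rot p q -> tle p q 1.
Proof.
elim=> [a b c|a a' b _ IH|a b b' _ IH].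
- by apply: (@tle_node a (Node b Leaf) c _ _ 0 0); apply: tle_refl.
- by apply: (@tle_node a Leaf b a' b 1 0); rewrite ?tcat0 //; apply: tle_refl.
- by apply: (@tle_node a Leaf b a b' 0 1); rewrite ?tcat0 //; apply: tle_refl.
Qed.

(** Superadditivity of the cost. From [p] to [r] the root absorbs [tcat d b'], where [b'] lies below
    the block [b] absorbed from [q] to [r]; since degrees only decrease upwards,
    [deg b' >= deg b]. *)
Lemma tle_trans q p r k l : tle p q k -> tle q r l ->
  exists2 m, k + l <= m & tle p r m.
Proof.
elim: r p q k l => [|r1 IH1 r2 IH2] p q k l Hpq Hqr.
  inversion Hqr; subst; inversion Hpq; subst; exists 0 => //; exact: tle_leaf.
move: Hqr Hpq => /tle_nodeP[a [b [q' [l1 [l2 [-> H1 H2 ->]]]]]].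
move=> /tle_nodeP[c [d [p' [k1 [k2 [-> G1 + ->]]]]]].
move=> /tle_catP[b' [p2 [m1 [m2 [-> F1 F2 ->]]]]].
have [n1 ln1 E1] := IH1 _ _ _ _ (tle_cat G1 F1) H1.
have [n2 ln2 E2] := IH2 _ _ _ _ F2 H2.
exists (n1 + n2 + deg (tcat d b')); first by rewrite deg_cat; have := tle_deg F1; lia.
by rewrite tcatA; apply: tle_node => //; rewrite tcatA.
Qed.

Lemma rotn_trans k l p q r : rotn k p q -> rotn l q r -> rotn (k + l) p r.
Proof. by elim=> // {}k t u v tu _ IH /IH; apply: rotnS. Qed.

Lemma rotn_left k a a' b : rotn k a a' -> rotn k (Node a b) (Node a' b).
Proof. by elim=> [t|m t u v tu _ IH]; [exact: rotn0 | exact: rotnS (rot_left _ tu) IH]. Qed.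

Lemma rotn_right k a b b' : rotn k b b' -> rotn k (Node a b) (Node a b').
Proof. by elim=> [t|m t u v tu _ IH]; [exact: rotn0 | exact: rotnS (rot_right _ tu) IH]. Qed.

(** Each root rotation moves the first remaining component of [b] under the root. *)
Lemma rotn_deg a b c : rotn (deg b) (Node a (tcat b c)) (Node (tcat a b) c).
Proof.
elim: b a => [|b1 _ b2 IH] a /=; first by rewrite tcat0; exact: rotn0.
apply: rotnS (rot_root _ _ _) _.
by have := IH (tcat a (Node b1 Leaf)); rewrite -tcatA.
Qed.

Lemma tle_rotn p q k : tle p q k -> rotn k p q.
Proof.
elim=> [|a b p' q1 q2 k1 k2 _ IH1 _ IH2]; first exact: rotn0.
rewrite addnC; apply: rotn_trans (rotn_deg _ _ _) _.
by apply: rotn_trans (rotn_left _ IH1) (rotn_right _ IH2).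
Qed.

Lemma rotn_tle p q k : rotn k p q -> exists2 m, k <= m & tle p q m.
Proof.
elim=> [t|l t u v /rot_tle tu _ [m lm uv]]; first by exists 0 => //; exact: tle_refl.
by have [m' lm' tv] := tle_trans tu uv; exists m' => //; lia.
Qed.

(* After [trev] a tree is read off the last return of a path, and path rotations become
   the usual rotations of binary trees, which [swap] reverses. *)
Inductive brot : tree -> tree -> Prop :=
| brot_root a b c : brot (Node a (Node b c)) (Node (Node a b) c)
| brot_left a a' b : brot a a' -> brot (Node a b) (Node a' b)
| brot_right a b b' : brot b b' -> brot (Node a b) (Node a b').

Lemma brot_swap t u : brot t u -> brot (swap u) (swap t).
Proof. by elim=> [a b c|a a' b _|a b b' _] /=; constructor. Qed.

Lemma brot_cat2l a b b' : brot b b' -> brot (tcat a b) (tcat a b').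
Proof. by move=> H; elim: a => //= a _ c; apply: brot_right. Qed.

Lemma brot_cat2r a a' b : brot a a' -> brot (tcat a b) (tcat a' b).
Proof. by elim=> [c d e|c c' d|c d d' _] /=; constructor. Qed.

Lemma rot_cat2r a a' b : rot a a' -> rot (tcat a b) (tcat a' b).
Proof. by elim=> [c d e|c c' d|c d d' _] /=; constructor. Qed.

Lemma rot_trev t u : rot t u -> brot (trev t) (trev u).
Proof.
elim=> [a b c|a a' b _ IH|a b b' _ IH] /=.
- by rewrite trev_cat -tcatA; apply: brot_cat2l; apply: brot_root.
- by apply: brot_cat2l; apply: brot_left.
- exact: brot_cat2r.
Qed.

Lemma brot_trev t u : brot t u -> rot (trev t) (trev u).
Proof.
elim=> [a b c|a a' b _ IH|a b b' _ IH] /=.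
- by rewrite -tcatA; apply: rot_cat2l; apply: rot_root.
- by apply: rot_cat2l; apply: rot_left.
- exact: rot_cat2r.
Qed.

(** The order-reversing involution psi: [trev] passes to the last-return decomposition, where [swap]
    is the left-right mirror. *)
Definition mirror t := trev (swap (trev t)).

Lemma mirrorK : involutive mirror.
Proof. by move=> t; rewrite /mirror trevK swapK trevK. Qed.

Lemma rotn_mirror k t u : rotn k t u -> rotn k (mirror u) (mirror t).
Proof.
elim=> [v|m v w x /rot_trev/brot_swap/brot_trev vw _ IH]; first exact: rotn0.
by rewrite -addn1; apply: rotn_trans IH (rotnS vw (rotn0 _)).
Qed.

(** * Intervals as labelled trees *)

(* The label of a node is the number of children of the corresponding node of [lower]. *)
Inductive ltree := LLeaf | LNode of nat & ltree & ltree.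

Fixpoint ttake k t := if (k, t) is (k'.+1, Node a b) then Node a (ttake k' b) else Leaf.
Fixpoint tdrop k t := if (k, t) is (k'.+1, Node a b) then tdrop k' b else t.

Fixpoint upper d := if d is LNode _ a b then Node (upper a) (upper b) else Leaf.

Fixpoint lower d :=
  if d is LNode l a b then
    Node (ttake l (lower a)) (tcat (tdrop l (lower a)) (lower b))
  else Leaf.

Fixpoint valid d :=
  if d is LNode l a b then [&& l <= deg (lower a), valid a & valid b] else true.

Fixpoint ldist d :=
  if d is LNode l a b then ldist a + ldist b + (deg (lower a) - l) else 0.

Fixpoint lcat d e := if d is LNode l a b then LNode l a (lcat b e) else e.

Fixpoint lrev d :=
  if d is LNode l a b then lcat (lrev b) (LNode l (lrev a) LLeaf) else LLeaf.

Lemma tcat_take_drop k t : tcat (ttake k t) (tdrop k t) = t.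
Proof. by elim: k t => [|k IH] [|a b] //=; rewrite IH. Qed.

Lemma ttake_cat t u : ttake (deg t) (tcat t u) = t.
Proof. by elim: t => [|a _ b /= ->] //; case: u. Qed.

Lemma tdrop_cat t u : tdrop (deg t) (tcat t u) = u.
Proof. by elim: t => //; case: u. Qed.

Lemma deg_take k t : k <= deg t -> deg (ttake k t) = k.
Proof. by elim: k t => [|k IH] [|a b] //= kt; rewrite IH. Qed.

Lemma deg_drop k t : deg (tdrop k t) = deg t - k.
Proof. by elim: k t => [|k IH] [|a b] //=. Qed.

Lemma lcatA d e f : lcat d (lcat e f) = lcat (lcat d e) f.
Proof. by elim: d => //= l a _ b ->. Qed.

Lemma lcat0 d : lcat d LLeaf = d.
Proof. by elim: d => //= l a _ b ->. Qed.

Lemma lrev_cat d e : lrev (lcat d e) = lcat (lrev e) (lrev d).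
Proof. by elim: d => [|l a _ b /= ->] /=; rewrite ?lcat0 ?lcatA. Qed.

Lemma lrevK : involutive lrev.
Proof. by elim=> //= l a IHa b IHb; rewrite lrev_cat /= IHa IHb. Qed.

Lemma lower_cat d e : lower (lcat d e) = tcat (lower d) (lower e).
Proof. by elim: d => //= l a _ b ->; rewrite tcatA. Qed.

Lemma upper_cat d e : upper (lcat d e) = tcat (upper d) (upper e).
Proof. by elim: d => //= l a _ b ->. Qed.

Lemma valid_cat d e : valid (lcat d e) = valid d && valid e.
Proof. by elim: d => //= l a _ b ->; rewrite !andbA. Qed.

Lemma ldist_cat d e : ldist (lcat d e) = ldist d + ldist e.
Proof. by elim: d => //= l a _ b ->; lia. Qed.

Lemma upper_rev d : upper (lrev d) = trev (upper d).
Proof. by elim: d => //= l a IHa b IHb; rewrite upper_cat /= IHa IHb. Qed.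

(** A root with label [l] adds [1 + (deg (lower a) - l)] to the degree, whatever its place among its
    siblings. Hence reflection keeps labels within their bounds. *)
Lemma deg_lower_rev d : deg (lower (lrev d)) = deg (lower d).
Proof.
elim: d => //= l a IHa b IHb.
rewrite lower_cat deg_cat /= !deg_cat !deg_drop IHa IHb /=; lia.
Qed.

Lemma valid_rev d : valid (lrev d) = valid d.
Proof.
by elim: d => //= l a IHa b IHb; rewrite valid_cat /= deg_lower_rev IHa IHb andbT andbC andbA.
Qed.

Lemma ldist_rev d : ldist (lrev d) = ldist d.
Proof. by elim: d => //= l a IHa b IHb; rewrite ldist_cat /= deg_lower_rev IHa IHb; lia. Qed.

(** Contacts of a forest are concatenated over its components, so cutting [lower a] after [l]
    components keeps its list intact and only the root contributes [l]. *)
Lemma contacts_lower l a b : l <= deg (lower a) ->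
  contacts (lower (LNode l a b)) = l :: contacts (lower a) ++ contacts (lower b).
Proof.
move=> la; rewrite /= deg_take // contacts_cat catA -contacts_cat.
by rewrite tcat_take_drop.
Qed.

Lemma contacts_lower_rev d : valid d ->
  perm_eq (contacts (lower (lrev d))) (contacts (lower d)).
Proof.
elim: d => // l a IHa b IHb /and3P[la va vb]; rewrite [lrev _]/= lower_cat contacts_cat.
rewrite !contacts_lower ?deg_lower_rev //= cats0.
by rewrite perm_catC /= perm_cons perm_cat ?IHa ?IHb.
Qed.

Lemma valid_tle d : valid d -> tle (lower d) (upper d) (ldist d).
Proof.
elim: d => [|l a IHa b IHb] /=; first by move=> _; exact: tle_leaf.
move=> /and3P[la /IHa va /IHb vb]; rewrite -deg_drop.
by apply: tle_node => //; rewrite tcat_take_drop.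
Qed.

Lemma tle_valid p q k : tle p q k ->
  exists d, [/\ valid d, lower d = p, upper d = q & ldist d = k].
Proof.
elim=> [|a b p' q1 q2 k1 k2 _ [d1 [v1 l1 u1 e1]] _ [d2 [v2 l2 u2 e2]]].
  by exists LLeaf.
exists (LNode (deg a) d1 d2); split=> /=.
- by rewrite v1 v2 l1 deg_cat leq_addr.
- by rewrite l1 l2 ttake_cat tdrop_cat.
- by rewrite u1 u2.
- by rewrite e1 e2 l1 deg_cat addKn.
Qed.

(** Takes leading components as long as they fit into [k] nodes. Sizes agree in the lower and upper
    trees, so this cut can be found from the upper tree alone. *)
Fixpoint stake k t :=
  if t is Node a b then
    if tsize a < k then Node a (stake (k - (tsize a).+1) b) else Leaf
  else Leaf.
Fixpoint sdrop k t :=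
  if t is Node a b then
    if tsize a < k then sdrop (k - (tsize a).+1) b else t
  else Leaf.

Lemma stake_cat t u : stake (tsize t) (tcat t u) = t.
Proof.
elim: t => [|a _ b IH] /=; first by case: u.
by rewrite ltnS leq_addr subSS addKn IH.
Qed.

Lemma sdrop_cat t u : sdrop (tsize t) (tcat t u) = u.
Proof.
elim: t => [|a _ b IH] /=; first by case: u.
by rewrite ltnS leq_addr subSS addKn IH.
Qed.

(* In [lower (LNode l a b)] the root block has [l] children, and the blocks of [lower a]
   and [lower b] are separated by the size of [upper a]. *)
Fixpoint label p q :=
  if (p, q) is (Node a p', Node q1 q2) then
    let t := tcat a p' in
    LNode (deg a) (label (stake (tsize q1) t) q1) (label (sdrop (tsize q1) t) q2)
  else LLeaf.

Lemma tsize_lower d : tsize (lower d) = tsize (upper d).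
Proof.
elim: d => //= l a IHa b IHb.
by rewrite tsize_cat addnA -tsize_cat tcat_take_drop IHa IHb.
Qed.

Lemma label_lower_upper d : valid d -> label (lower d) (upper d) = d.
Proof.
elim: d => //= l a IHa b IHb /and3P[la va vb].
rewrite deg_take // tcatA tcat_take_drop -tsize_lower.
by rewrite stake_cat sdrop_cat IHa ?IHb.
Qed.

Lemma tle_label p q k : tle p q k ->
  [/\ valid (label p q), lower (label p q) = p,
      upper (label p q) = q & ldist (label p q) = k].
Proof. by move=> /tle_valid[d [vd <- <- <-]]; rewrite label_lower_upper. Qed.

(** The labelling, and with it the cost, is a function of the two trees. *)
Lemma tle_uniq p q k l : tle p q k -> tle p q l -> k = l.
Proof. by move=> /tle_label[_ _ _ <-] /tle_label[_ _ _ <-]. Qed.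

Lemma rot_neq p q : rot p q -> p <> q.
Proof. by move=> /rot_tle H E; move: H; rewrite E => /tle_uniq /(_ (tle_refl q)). Qed.

(** Mirroring a chain of rotations shows that the cost cannot drop; mirroring twice returns to the
    same pair, so by uniqueness it cannot grow either. *)
Lemma tle_mirror p q k : tle p q k -> tle (mirror q) (mirror p) k.
Proof.
move=> H; have [l kl Hl] := rotn_tle (rotn_mirror (tle_rotn H)).
have [m lm] := rotn_tle (rotn_mirror (tle_rotn Hl)); rewrite !mirrorK => Hm.
have km := tle_uniq H Hm.
by have -> : k = l by lia.
Qed.

(** * The involution on tree intervals *)

Definition left_branch (I : tree * tree) :=
  let d := lrev (label I.1 I.2) in (lower d, upper d).

Definition complement (I : tree * tree) := (mirror I.2, mirror I.1).

Definition rise_contact I := left_branch (complement (left_branch I)).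

Lemma tle_left_branch I k : tle I.1 I.2 k -> tle (left_branch I).1 (left_branch I).2 k.
Proof.
by move=> /tle_label[vd _ _ <-]; rewrite -ldist_rev; apply: valid_tle; rewrite valid_rev.
Qed.

Lemma left_branchK I k : tle I.1 I.2 k -> left_branch (left_branch I) = I.
Proof.
case: I => p q /tle_label[vd lo up _]; rewrite /left_branch /=.
by rewrite label_lower_upper ?valid_rev // lrevK lo up.
Qed.

Lemma complementK : involutive complement.
Proof. by case=> p q; rewrite /complement /= !mirrorK. Qed.

Lemma tle_rise_contact I k : tle I.1 I.2 k -> tle (rise_contact I).1 (rise_contact I).2 k.
Proof. by move=> /tle_left_branch/tle_mirror H; apply: tle_left_branch. Qed.

Lemma rise_contactK I k : tle I.1 I.2 k -> rise_contact (rise_contact I) = I.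
Proof.
move=> H; have H1 := tle_left_branch H; have H2 := tle_mirror H1.
rewrite /rise_contact (@left_branchK (complement (left_branch I)) k) //.
by rewrite complementK (left_branchK H).
Qed.

Lemma left_branch_upper I k : tle I.1 I.2 k -> (left_branch I).2 = trev I.2.
Proof. by move=> /tle_label[_ _ up _]; rewrite /left_branch /= upper_rev up. Qed.

Lemma deg_left_branch I k : tle I.1 I.2 k -> deg (left_branch I).1 = deg I.1.
Proof. by move=> /tle_label[_ lo _ _]; rewrite /left_branch /= deg_lower_rev lo. Qed.

Lemma contacts_left_branch I k : tle I.1 I.2 k ->
  perm_eq (contacts (left_branch I).1) (contacts I.1).
Proof.
by move=> /tle_label[vd lo _ _]; have := contacts_lower_rev vd; rewrite lo.
Qed.

(** The first reflection applies a [trev] to the upper tree that cancels the inner [trev] of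
    [mirror]; the last one cancels its outer [trev] in the new upper tree. What remains is [swap],
    which exchanges contacts and rises, and maps preserving contacts. *)
Lemma rise_contact_stats I k : tle I.1 I.2 k ->
  [/\ deg (rise_contact I).1 = rise I.2, rise (rise_contact I).2 = deg I.1,
      perm_eq (contacts (rise_contact I).1) (rises I.2) &
      perm_eq (rises (rise_contact I).2) (contacts I.1)].
Proof.
move=> H; have H1 := tle_left_branch H.
have H2 : tle (complement (left_branch I)).1 (complement (left_branch I)).2 k.
  exact: tle_mirror.
have e1 : (complement (left_branch I)).1 = trev (swap I.2).
  by rewrite -[LHS]/(mirror _.2) (left_branch_upper H) /mirror trevK.
have e2 : (rise_contact I).2 = swap (trev (left_branch I).1).
  by rewrite /rise_contact (left_branch_upper H2) -[X in trev X]/(mirror _.1) /mirror trevK.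
split.
- by rewrite (deg_left_branch H2) e1 deg_trev deg_swap.
- by rewrite -deg_swap e2 swapK deg_trev (deg_left_branch H).
- apply: perm_trans (contacts_left_branch H2) _; rewrite e1.
  exact: perm_trans (contacts_trev _) (contacts_swap _).
- rewrite e2 perm_sym; apply: perm_trans (contacts_swap _); rewrite swapK perm_sym.
  exact: perm_trans (contacts_trev _) (contacts_left_branch H).
Qed.

(** * Trees and Dyck words *)

Notation ups := (count (fun b : bool => b)).
Notation downs := (count negb).

Fixpoint height_ok h w :=
  if w is b :: w' then if b then height_ok h.+1 w' else (0 < h) && height_ok h.-1 w'
  else h == 0.

Lemma height_okE h w :
  height_ok h w = all (fun k => downs (take k w) <= h + ups (take k w)) (iota 0 (size w).+1)
                  && (h + ups w == downs w).
Proof.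
elim: w h => [|b w IH] h; first by rewrite /= addn0.
rewrite -[iota _ _]/(0 :: iota (1 + 0) (size w).+1) iotaDl.
have all0 (P : pred nat) s : P 0 -> all P (0 :: s) = all P s by move=> /= ->.
case: b => [|].
  rewrite all0 // all_map /= IH; congr (_ && _); last by lia.
  by apply: eq_all => k /=; rewrite !add0n; lia.
case: h => [|h]; first by rewrite /= take0.
rewrite all0 // all_map /= IH; congr (_ && _).
Qed.

Lemma dyck_word_ok w : dyck_word w = height_ok 0 w.
Proof. by rewrite height_okE. Qed.

Lemma height_ok_word h t w : height_ok h (word t ++ w) = height_ok h w.
Proof.
by elim: t h w => //= a IHa b IHb h w; rewrite -catA /= IHa /= IHb.
Qed.

Lemma dyck_word_word t : dyck_word (word t).
Proof. by rewrite dyck_word_ok -[word t]cats0 height_ok_word. Qed.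

(** The word is cut at the down-steps that first reach each new lowest level. *)
Lemma height_ok_forest h w : height_ok h w ->
  exists t s, size s = h /\ w = word t ++ flatten [seq false :: word u | u <- s].
Proof.
elim: w h => [|[] w IH] h /=; first by move=> /eqP ->; exists Leaf, [::].
  by move=> /IH[t [[|u s] [// [<-] ->]]]; exists (Node t u), s; rewrite /= -catA.
by case: h => //= h /IH[t [s [<- ->]]]; exists Leaf, (t :: s).
Qed.

Lemma dyck_word_exists w : dyck_word w -> exists t, w = word t.
Proof.
rewrite dyck_word_ok => /height_ok_forest[t [s [/size0nil -> ->]]].
by exists t; rewrite cats0.
Qed.

(* Reads a word from the right, keeping the stack of forests between the open down-steps. *)
Definition parse_step (b : bool) (s : seq tree) :=
  if b then (if s is a :: c :: s' then Node a c :: s' else s) else Leaf :: s.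

Definition parse w := head Leaf (foldr parse_step [:: Leaf] w).

Lemma parse_word t : parse (word t) = t.
Proof.
(* Generalised to an arbitrary stack, whose top forest is extended on the left. *)
suff H u s : foldr parse_step (u :: s) (word t) = tcat t u :: s by rewrite /parse H tcat0.
by elim: t u s => //= a IHa b IHb u s; rewrite foldr_cat /= IHb IHa tcat0.
Qed.

Lemma size_word t : size (word t) = 2 * tsize t.
Proof. by elim: t => //= a IHa b IHb; rewrite size_cat /= IHa IHb; lia. Qed.

Lemma dyckP n w : dyck n w -> exists2 t, w = word t & tsize t = n.
Proof.
move=> /andP[/eqP sw /dyck_word_exists[t wt]]; exists t => //.
by move: sw; rewrite wt size_word; lia.
Qed.

Lemma dyck_wordE t : dyck (tsize t) (word t).
Proof. by rewrite /dyck size_word eqxx dyck_word_word. Qed.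

(** The displayed down-step is the first to go below height 0, which fixes the cut. *)
Lemma word_down_inj t u v w : word t ++ false :: v = word u ++ false :: w ->
  t = u /\ v = w.
Proof.
elim: t u v w => [|a IHa b IHb] [|c d] v w //=; first by case.
by case; rewrite -!catA /= => /IHa[-> /IHb[-> ->]].
Qed.

Lemma word_prefix t k : downs (take k (word t)) <= ups (take k (word t)).
Proof.
have [ks|/ltnW/take_oversize->] := leqP k (size (word t)); last first.
  by have /andP[_ /eqP->] := dyck_word_word t.
by have /andP[/allP-> //] := dyck_word_word t; rewrite mem_iota.
Qed.

(** The conditions that [rotation] puts on its factor [W]; they single out the paths [U b D]. *)
Definition prime_word w := [/\ head false w = true, w != [::], dyck_word w &
  forall k, 0 < k < size w -> ~~ dyck_word (take k w)].

Lemma prime_wordP w : prime_word w <-> exists b, w = word (Node b Leaf).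
Proof.
split=> [[hw _ /dyck_word_exists[t wt] pr] | [b ->]].
  move: hw pr; rewrite {}wt; case: t => [|b c] // _ pr.
  exists b; case: c pr => // c d /(_ (size (word (Node b Leaf)))).
  have e : word (Node b (Node c d)) = word (Node b Leaf) ++ word (Node c d).
    by rewrite /= -catA.
  rewrite e take_size_cat // dyck_word_word size_cat /= => H.
  by have : ~~ true by apply: H; lia.
split=> //; first exact: dyck_word_word.
case=> // k; rewrite /= size_cat addn1 ltnS => ks.
(* Such a prefix is an up-step followed by a prefix of [word b], so it ends above height 0. *)
rewrite takel_cat // /dyck_word /balanced /= add0n add1n.
by apply/nandP; right; rewrite gtn_eqF // ltnS word_prefix.
Qed.

Lemma rot_rotation t u : rot t u -> rotation (word t) (word u).
Proof.
elim=> [a b c|a a' b _ IH|a b b' _ IH] /=.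
- exists (true :: word a), (word (Node b Leaf)), (word c).
  have [|h h0 dw pr] := (prime_wordP (word (Node b Leaf))).2; first by exists b.
  by do ![split] => //=; rewrite ?word_cat /= -!catA //= -catA.
- case: IH => [x [w [y [-> [h [h0 [dw [pr ->]]]]]]]].
  exists (true :: x), w, (y ++ false :: word b).
  by do ![split] => //=; rewrite -!catA /= -?catA.
- case: IH => [x [w [y [-> [h [h0 [dw [pr ->]]]]]]]].
  exists (true :: word a ++ false :: x), w, y.
  by do ![split] => //=; rewrite -!catA /= -?catA.
Qed.

(* The letter after [word t] plays the down-step that closes an enclosing excursion, which
   makes the induction on [t] go through. *)
Lemma rot_position t z u b v :
  word t ++ false :: z = u ++ false :: true :: word b ++ false :: v ->
  [\/ u = word t /\ z = true :: word b ++ false :: v,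
      exists2 t', rot t t' &
        u ++ true :: word b ++ false :: false :: v = word t' ++ false :: z |
      exists2 u', u = word t ++ false :: u' &
        z = u' ++ false :: true :: word b ++ false :: v].
Proof.
elim: t z u v => [|a IHa c IHc] z [|[] u] v //=.
- by case=> ->; constructor 1.
- by case=> ->; constructor 3; exists u.
case; rewrite -catA /= => /IHa[[-> e]|[a' ra e]|[u' -> /IHc[[-> ->]|[c' rc e]|[u'' -> ->]]]].
- constructor 2; case: c {IHc} e => [|b' c] //= [].
  rewrite -catA /= => /word_down_inj[-> <-].
  exists (Node (tcat a (Node b Leaf)) c); first exact: rot_root.
  by rewrite /= word_cat /= -!catA /= -!catA.
- constructor 2; exists (Node a' c); first exact: rot_left.
  by rewrite /= e -catA.
- by constructor 1.
- constructor 2; exists (Node a c'); first exact: rot_right.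
  by rewrite /= -!catA /= e.
by constructor 3; exists u''; rewrite /= -?catA.
Qed.

Lemma rotation_rot t w : rotation (word t) w -> exists2 u, rot t u & w = word u.
Proof.
move=> [u [W [v [e [h [h0 [dw [pr ->]]]]]]]].
have [b eW] : exists b, W = word (Node b Leaf) by apply/prime_wordP.
(* A closing down-step is appended so that [rot_position] applies with [z] empty, which excludes its
   first and third cases. *)
have : word t ++ false :: [::] = u ++ false :: true :: word b ++ false :: (v ++ [:: false]).
  by rewrite e eW /= -!catA /= -!catA.
case/rot_position=> [[]|[t' tt' e']|[u' _]] //; last by case: u'.
exists t' => //; rewrite eW; move: e'; rewrite -cat_rcons !cats1 => e'.
apply: (@rcons_injl _ false); rewrite -e' /= -!cats1 -!catA /= -!catA.
by [].
Qed.

(** * Chains and distance on Dyck words *)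

Lemma tle_tamari p q k : tle p q k -> tamari_le (word p) (word q).
Proof.
move=> /tle_rotn; elim=> [t|m t u v /rot_rotation tu _ uv]; first exact: rt_refl.
by apply: rt_trans uv; apply: rt_step.
Qed.

Lemma tamari_tle p w : tamari_le (word p) w -> exists q k, w = word q /\ tle p q k.
Proof.
move=> /clos_rt_rt1n_iff; move e: (word p) => x H.
elim: H p e => [y|y z x' yz _ IH] p e; first by exists p, 0; split=> //; exact: tle_refl.
move: yz; rewrite -e => /rotation_rot[r /rot_tle pr /esym /IH[q [k [-> rq]]]].
by have [m _ pq] := tle_trans pr rq; exists q, m.
Qed.

Lemma word_inj : injective word.
Proof. exact: can_inj parse_word. Qed.

(** A strict step has positive cost by [tle0], and costs are superadditive along the chain. *)
Lemma chain_length_le p q k s : tle p q k -> chain_from (word p) s (word q) -> size s <= k.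
Proof.
elim: s p k => //= y s IH p k pq [[/tamari_tle[r [l [-> pr]]] ne] ch].
have [x [m [/word_inj ex rq]]] : exists x m, word q = word x /\ tle r x m.
  apply: tamari_tle; elim: (s) (word r) ch => [|z s' IHs] x /=; first by move=> ->; exact: rt_refl.
  by move=> [[xz _] /IHs]; apply: rt_trans.
rewrite -ex in rq; have l0 : l <> 0 by move=> l0; apply: ne; rewrite (tle0 pr l0).
have [n ln pq'] := tle_trans pr rq.
by have := IH _ _ rq ch; rewrite (tle_uniq pq pq'); lia.
Qed.

Lemma chain_of_rotn k p q : rotn k p q ->
  exists s, [/\ all (dyck (tsize p)) s, chain_from (word p) s (word q) & size s = k].
Proof.
elim=> [t|m t u v tu _ [s [ds ch <-]]]; first by exists [::].
have sz : tsize t = tsize u := tle_size (rot_tle tu).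
exists (word u :: s); split=> //=; first by rewrite sz dyck_wordE ds.
split=> //; split; first by apply: rt_step; exact: rot_rotation.
by move/word_inj; apply: rot_neq.
Qed.

Lemma is_distE p q k l : tle p q k -> is_dist (tsize p) (word p) (word q) l <-> l = k.
Proof.
move=> pq; have [s0 [ds0 ch0 sz0]] := chain_of_rotn (tle_rotn pq).
split=> [[[s [_ [ch <-]]] /(_ _ ds0 ch0)]|->].
  by rewrite sz0 => ks; have := chain_length_le pq ch; lia.
by split=> [|s _]; [exists s0 | exact: chain_length_le].
Qed.

(** * Statistics *)

(** Serves both [up_pos] and [down_pos]; their defaults for [nth] differ, hence the parameter
    [x0]. *)
Lemma nth_positions (p : pred bool) x0 u b v : p b ->
  nth 0 [seq j <- iota 0 (size (u ++ b :: v)) | p (nth x0 (u ++ b :: v) j)] (count p u)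
  = size u.
Proof.
move=> pb; rewrite size_cat iotaD filter_cat add0n.
have -> : [seq j <- iota 0 (size u) | p (nth x0 (u ++ b :: v) j)]
          = [seq j <- iota 0 (size u) | p (nth x0 u j)].
  by apply: eq_in_filter => j; rewrite mem_iota => /andP[_ ju]; rewrite nth_cat ju.
have sz : size [seq j <- iota 0 (size u) | p (nth x0 u j)] = count p u.
  by rewrite size_filter -(count_map (nth x0 u) p) map_nth_iota0 // take_size.
by rewrite nth_cat sz ltnn subnn /= nth_cat ltnn subnn /= pb.
Qed.

Lemma find_iota (p : pred nat) m n : m < n -> p m -> (forall j, j < m -> ~~ p j) ->
  find p (iota 0 n) = m.
Proof.
move=> mn pm np; rewrite -(subnKC mn) -addn1 -addnA iotaD find_cat size_iota.
rewrite ifF /= ?add0n ?pm ?addn0 //.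
apply/hasP=> -[j]; rewrite mem_iota => /andP[_ /np /negP].
by [].
Qed.

Lemma returns_word t : returns (word t) = deg t.
Proof.
(* Visits to height 0 when [w] is read from height [h]; a Dyck factor read at positive height makes
   none. *)
pose F h w := count (fun k => h + ups (take k w) == downs (take k w)) (iota 1 (size w)).
suff H h u w : F h (word u ++ w) = (h == 0) * deg u + F h w.
  by have := H 0 t [::]; rewrite cats0 mul1n addn0.
have Fcons h' b w' : F h' (b :: w') =
    (h' + b == ~~ b :> nat) +
    count (fun k => h' + (b + ups (take k w')) == ~~ b + downs (take k w'))
      (iota 1 (size w')).
  rewrite /F [size _]/= -[iota _ _]/(1 :: iota (1 + 1) (size w')) iotaDl /= count_map.
  by rewrite take0 /= !addn0.
have Fup h' w' : F h' (true :: w') = F h'.+1 w'.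
  rewrite Fcons addn1 /=; apply: eq_count => k /=; lia.
have Fdown h' w' : F h'.+1 (false :: w') = (h' == 0) + F h' w'.
  rewrite Fcons addn0 /=; congr (_ + _); apply: eq_count => k /=; lia.
elim: u h w => [|a IHa b IHb] h w; first by rewrite muln0.
rewrite /= -catA Fup IHa /= Fdown IHb; lia.
Qed.

Lemma ups_word t : ups (word t) = tsize t.
Proof. by elim: t => //= a IHa b IHb; rewrite count_cat /= IHa IHb. Qed.

Lemma downs_word t : downs (word t) = tsize t.
Proof. by elim: t => //= a IHa b IHb; rewrite count_cat /= IHa IHb; lia. Qed.

Lemma match_posE u a v :
  match_pos (u ++ true :: word a ++ false :: v) (size u) = (size u).+1 + size (word a).
Proof.
set z := word a ++ false :: v; congr addn.
have bal : ups (word a) = downs (word a) by rewrite ups_word downs_word.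
have tk q : take ((size u).+1 + q).+1 (u ++ true :: z) = u ++ true :: take q.+1 z.
  rewrite take_cat ifF; last by lia.
  by have -> : ((size u).+1 + q).+1 - size u = q.+2 by lia.
have nt q : nth true (u ++ true :: z) ((size u).+1 + q) = nth true z q.
  rewrite nth_cat ifF; last by lia.
  by have -> : (size u).+1 + q - size u = q.+1 by lia.
have tu : take (size u) (u ++ true :: z) = u by rewrite take_size_cat.
apply: find_iota => [|/=|j ja /=].
- by rewrite /z !size_cat /= size_cat /=; lia.
- rewrite nt tk tu /z nth_cat ltnn subnn /= take_cat ifF; last by lia.
  by rewrite subSnn /= !count_cat /= count_cat count_cat /= take0 /= bal; lia.
(* Inside [word a] the path stays above the starting height of the up-step, so the height test
   fails. *)
rewrite tk tu nt negb_and; apply/orP; right.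
rewrite !count_cat /= /z takel_cat //.
by have := word_prefix a j.+1; lia.
Qed.

Lemma contacts_nth t i : i < tsize t -> exists u a v,
  [/\ word t = u ++ true :: word a ++ false :: v, ups u = i & nth 0 (contacts t) i = deg a].
Proof.
elim: t i => // a IHa b IHb [|i] /=; first by exists [::], a, (word b).
rewrite ltnS => it; rewrite nth_cat size_contacts.
case: ltnP => [/IHa[u [c [v [-> <- ->]]]]|ai].
  by exists (true :: u), c, (v ++ false :: word b); rewrite /= -!catA /= -catA.
have [|u [c [v [-> e ->]]]] := IHb (i - tsize a); first by lia.
exists (true :: word a ++ false :: u), c, v; split=> //.
  by rewrite /= -!catA.
by rewrite /= count_cat /= e ups_word; lia.
Qed.

Lemma ci_word t i : i < tsize t -> ci (word t) i.+1 = nth 0 (contacts t) i.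
Proof.
move=> /contacts_nth[u [a [v [e <- ->]]]]; rewrite /ci /up_pos e.
rewrite (@nth_positions id) // match_posE -returns_word; congr returns.
rewrite -cat_rcons catA take_size_cat ?size_cat ?size_rcons //.
by rewrite drop_size_cat // size_rcons.
Qed.

Lemma find_down v w : find negb (v ++ false :: w) = find negb v.
Proof. by rewrite find_cat /= addn0; case: ifP => // /negbT/hasNfind ->. Qed.

Lemma r0_word t : r0 (word t) = rise t.
Proof. by rewrite /r0; elim: t => //= a <- b _; rewrite find_down. Qed.

Lemma rises_nth t i : i < tsize t -> exists u v,
  [/\ word t = u ++ false :: v, downs u = i &
      find negb v = nth 0 (rises t) i].
Proof.
elim: t i => // a IHa b IHb i /=; rewrite ltnS => it.
have da := downs_word a.
rewrite nth_cat size_rises; case: ltnP => [/IHa[u [v [-> <- e]]]|ai].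
  exists (true :: u), (v ++ false :: word b); split=> //=; first by rewrite -catA.
  by rewrite find_down.
case: (i - tsize a) (subnKC ai) => [|j] ij /=.
  exists (true :: word a), (word b); split=> //=; first by lia.
  exact: r0_word.
have [|u [v [-> e e']]] := IHb j; first by lia.
exists (true :: word a ++ false :: u), v; split=> //=; first by rewrite -catA.
by rewrite count_cat /= e da; lia.
Qed.

Lemma ri_word t i : i < tsize t -> ri (word t) i.+1 = nth 0 (rises t) i.
Proof.
move=> /rises_nth[u [v [e <- <-]]]; rewrite /ri /down_pos e.
by rewrite (@nth_positions negb) // -cat_rcons drop_size_cat // size_rcons.
Qed.

(* The last entries of the full contact and rise sequences vanish; [cvec] and [rvec] omit them. *)
Lemma perm_drop_last (f : nat -> nat) s : 0 < size s -> last 0 s = 0 ->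
  (forall i, i < size s -> f i.+1 = nth 0 s i) ->
  perm_eq (0 :: [seq f i | i <- iota 1 (size s).-1]) s.
Proof.
case/lastP: s => // s x _; rewrite last_rcons size_rcons => -> fE.
have -> : [seq f i | i <- iota 1 (size s)] = s; last by rewrite perm_sym perm_rcons.
rewrite (iotaDl 1 0) -map_comp -[RHS](mkseq_nth 0); apply/eq_in_map => i.
rewrite mem_iota => /andP[_ si] /=; rewrite add1n fE ?nth_rcons ?si //.
exact: leqW.
Qed.

Lemma cvec_word t : 0 < tsize t -> perm_eq (0 :: cvec (tsize t) (word t)) (contacts t).
Proof.
rewrite /cvec -size_contacts => t0; apply: perm_drop_last => //.
  exact: last_contacts.
by move=> i; rewrite size_contacts; exact: ci_word.
Qed.

Lemma rvec_word t : 0 < tsize t -> perm_eq (0 :: rvec (tsize t) (word t)) (rises t).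
Proof.
rewrite /rvec -size_rises => t0; apply: perm_drop_last => //.
  exact: last_rises.
by move=> i; rewrite size_rises; exact: ri_word.
Qed.

Lemma intervalP n I : interval n I -> exists p q k,
  [/\ I = (word p, word q), tsize p = n & tle p q k].
Proof.
case: I => P Q [/= /dyckP[p -> sp] [_ /tamari_tle[q [k [-> pq]]]]].
by exists p, q, k.
Qed.

Theorem theorem54 (n : nat) : 1 <= n ->
  exists beta : seq bool * seq bool -> seq bool * seq bool,
    forall I : seq bool * seq bool, interval n I ->
      [/\ interval n (beta I),
          beta (beta I) = I,
          c0 (beta I).1 = r0 I.2 /\ r0 (beta I).2 = c0 I.1,
          perm_eq (cvec n (beta I).1) (rvec n I.2) /\
          perm_eq (rvec n (beta I).2) (cvec n I.1) &
          forall k, is_dist n I.1 I.2 k <-> is_dist n (beta I).1 (beta I).2 k].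
Proof.
move=> n0.
pose words (J : tree * tree) := (word J.1, word J.2).
(* The tree involution is carried over to paths, with [parse] inverting [word]. *)
exists (fun I => words (rise_contact (parse I.1, parse I.2))) => _ /intervalP[p [q [k [-> sp pq]]]].
have wordsK J : (parse (words J).1, parse (words J).2) = J.
  by case: J => u v; rewrite /= !parse_word.
have -> : (parse (word p, word q).1, parse (word p, word q).2) = (p, q) := wordsK (p, q).
rewrite wordsK.
have H : tle (p, q).1 (p, q).2 k by [].
have [] := rise_contact_stats H; have := rise_contactK H; have := tle_rise_contact H.
set J := rise_contact (p, q) => H' -> dP rQ cP cQ.
have sq : tsize q = n by rewrite -(tle_size pq).
have sP : tsize J.1 = n.
  rewrite -size_contacts (perm_size cP) size_rises; exact: sq.
have sQ : tsize J.2 = n by rewrite -(tle_size H').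
split=> //.
- split; first by rewrite -sP dyck_wordE.
  by split; [rewrite -sQ dyck_wordE | exact: tle_tamari H'].
- by rewrite /c0 !returns_word !r0_word.
(* Restoring the omitted final zero on both sides reduces the claim to the full contact and rise
   lists of the trees. *)
- split; rewrite -(perm_cons 0).
    apply: perm_trans (_ : perm_eq (contacts J.1) _).
      by rewrite -sP; apply: cvec_word; rewrite sP.
    by apply: perm_trans cP _; rewrite perm_sym -sq; apply: rvec_word; rewrite sq.
  apply: perm_trans (_ : perm_eq (rises J.2) _).
    by rewrite -sQ; apply: rvec_word; rewrite sQ.
  by apply: perm_trans cQ _; rewrite perm_sym -sp; apply: cvec_word; rewrite sp.
move=> l; have e := is_distE l pq; have e' := is_distE l H'; rewrite sp in e; rewrite sP in e'.
exact: iff_trans e (iff_sym e').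
Qed.
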